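(* Let $X$ be a set, let $\mathbf{d}:X\times X\to[0,\infty]$ be a distance, and suppose $\underline{\mathbf{d}}\circ\mathord{\leq^{\mathbf{d}\mathcal{P}}}\precapprox\mathbf{d}\mathcal{P}$. Then for every net $(x_\lambda)$ in $X$: $(x_\lambda)$ is $\mathbf{d}$-pre-Cauchy if and only if there exists a $<^{\mathbf{d}}$-directed subset $Y\subseteq X$ with $Y\equiv^{\mathbf{d}}(x_\lambda)$.
   Context: Write $x\mathbf{d}y=\mathbf{d}(x,y)$. Conventions: $a_+=\max(a,0)$, $\infty-\infty=0$, $\inf\emptyset=\infty$, $\sup\emptyset=0$ in $[0,\infty]$. A relation is identified with the function equal to $0$ where it holds and $\infty$ elsewhere. For $\mathbf{f}:A\times C\to[0,\infty]$, $\mathbf{g}:C\times B\to[0,\infty]$, $a(\mathbf{f}\circ\mathbf{g})b=\inf_{c\in C}(a\mathbf{f}c+c\mathbf{g}b)$. $\mathbf{d}$ is a distance if $x\mathbf{d}y\leq x\mathbf{d}z+z\mathbf{d}y$ for all $x,y,z$. $z\underline{\mathbf{d}}y=\sup_{x\in X}(x\mathbf{d}y-x\mathbf{d}z)_+$. $\mathbf{d}\mathcal{P}:X\times\mathcal{P}(X)\to[0,\infty]$ is $x(\mathbf{d}\mathcal{P})Z=\sup_{z\in Z}x\mathbf{d}z$, and $x\leq^{\mathbf{d}\mathcal{P}}Z$ means $x(\mathbf{d}\mathcal{P})Z=0$. $x<^{\mathbf{d}}y$ means: there is $\epsilon>0$ such that for all $z\in X$, $y\underline{\mathbf{d}}z<\epsilon$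 implies $x\mathbf{d}z=0$. Uniform preorder: for $\mathbf{f},\mathbf{g}:A\times B\to[0,\infty]$, $\mathbf{f}\precapprox\mathbf{g}$ iff for every $Z\subseteq A\times B$, $\inf_{(a,b)\in Z}a\mathbf{g}b=0$ implies $\inf_{(a,b)\in Z}a\mathbf{f}b=0$ (equivalently, for all $\epsilon>0$ there is $\delta>0$ such that $a\mathbf{g}b<\delta$ implies $a\mathbf{f}b<\epsilon$ for all $a,b$). Nets $(x_\lambda)_{\lambda\in\Lambda}$ are indexed by non-empty sets $\Lambda$ with a transitive, possibly non-reflexive relation $\prec$ such that for all $\gamma,\delta$ there is $\lambda$ with $\gamma,\delta\prec\lambda$; limits and limits superior use tails $\{\lambda:\lambda\succ\gamma\}$. $(x_\lambda)$ is $\mathbf{d}$-pre-Cauchy iff $\lim_\gamma\limsup_\delta x_\gamma\mathbf{d}x_\delta=0$. $Y$ is $<^{\mathbf{d}}$-directed if every finite $F\subseteq Y$ (including $\emptyset$) has some $y\in Y$ with $x<^{\mathbf{d}}y$ for all $x\in F$. $Y\equiv^{\mathbf{d}}(x_\lambda)$ means: $\lim_\lambda y\mathbf{d}x_\lambda=0$ for all $y\in Y$, and $\lim_\lambda\inf_{y\in Y}x_\lambda\mathbf{d}y=0$. *)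

(* Defs.v *)
From HB Require Import structures.
From mathcomp Require Import all_boot all_order all_algebra.
From mathcomp Require Import all_classical all_reals all_analysis.
Set Implicit Arguments.
Unset Strict Implicit.
Unset Printing Implicit Defensive.
Import Order.TTheory GRing.Theory Num.Theory.
Import numFieldNormedType.Exports.
Local Open Scope classical_set_scope.
Local Open Scope ring_scope.
Local Open Scope ereal_scope.

(** Functions A x B -> [0, oo] are represented as curried functions into
    [\bar R]; nonnegativity is part of [is_distance]. *)

(* Supremum in [0, oo], so that the supremum of the empty set is 0 (whereas
   [ereal_sup set0 = -oo]).  [ereal_inf set0 = +oo] needs no adjustment. *)
Definition nneg_sup {R : realType} (S : set (\bar R)) : \bar R :=
  maxe (ereal_sup S) 0.

(* (a - b)_+ ; as [+oo - +oo = -oo] in [\bar R], its value at a = b = +oo is 0,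
   which agrees with the convention oo - oo = 0. *)
Definition subpos {R : realType} (a b : \bar R) : \bar R := maxe (a - b) 0.

Definition is_distance {R : realType} {X : Type} (d : X -> X -> \bar R) : Prop :=
  (forall x y, 0 <= d x y) /\ (forall x y z, d x y <= d x z + d z y).

(* A relation seen as a {0, oo}-valued function. *)
Definition rel_dist (R : realType) {A B : Type} (r : A -> B -> Prop)
  (a : A) (b : B) : \bar R := if `[< r a b >] then 0 else +oo.

Definition inf_comp {R : realType} {A C B : Type}
  (f : A -> C -> \bar R) (g : C -> B -> \bar R) (a : A) (b : B) : \bar R :=
  ereal_inf [set f a c + g c b | c in [set: C]].

(* z \underline{d} y. *)
Definition dlower {R : realType} {X : Type} (d : X -> X -> \bar R)
  (z y : X) : \bar R :=
  nneg_sup [set subpos (d x y) (d x z) | x in [set: X]].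

(* d P *)
Definition dpow {R : realType} {X : Type} (d : X -> X -> \bar R)
  (x : X) (Z : set X) : \bar R :=
  nneg_sup [set d x z | z in Z].

(* x <=^{d P} Z *)
Definition le_dpow {R : realType} {X : Type} (d : X -> X -> \bar R)
  (x : X) (Z : set X) : Prop := dpow d x Z = 0.

(* x <^d y *)
Definition lt_d {R : realType} {X : Type} (d : X -> X -> \bar R)
  (x y : X) : Prop :=
  exists2 e : R, (0 < e)%R & forall z : X, dlower d y z < e%:E -> d x z = 0.

(* The uniform preorder f \precapprox g. *)
Definition unif_le {R : realType} {A B : Type} (f g : A -> B -> \bar R) : Prop :=
  forall Z : set (A * B),
    ereal_inf [set g p.1 p.2 | p in Z] = 0 ->
    ereal_inf [set f p.1 p.2 | p in Z] = 0.

(* Index sets of nets: [prec] need not be reflexive. *)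
Definition net_index {L : Type} (prec : L -> L -> Prop) : Prop :=
  [/\ inhabited L,
      forall a b c, prec a b -> prec b c -> prec a c &
      forall a b, exists c, prec a c /\ prec b c].

Definition tails {L : Type} (prec : L -> L -> Prop) : set_system L :=
  filter_from [set: L] (fun g => [set l | prec g l]).

(* [limf_esup f (tails prec)] for nonnegative f; [limf_esup] itself requires
   its domain to be more than a bare type. *)
Definition net_limsup {R : realType} {L : Type} (prec : L -> L -> Prop)
  (f : L -> \bar R) : \bar R :=
  ereal_inf [set nneg_sup [set f l | l in [set l | prec g l]] | g in [set: L]].

Definition pre_cauchy {R : realType} {X : Type} (d : X -> X -> \bar R)
  {L : Type} (prec : L -> L -> Prop) (x : L -> X) : Prop :=
  (fun g => net_limsup prec (fun l => d (x g) (x l))) @ tails prec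
    --> (0 : \bar R).

Definition lt_directed {R : realType} {X : Type} (d : X -> X -> \bar R)
  (Y : set X) : Prop :=
  forall F : set X, finite_set F -> F `<=` Y ->
    exists2 y, Y y & forall x, F x -> lt_d d x y.

(* Y \equiv^d (x_l) *)
Definition net_equiv {R : realType} {X : Type} (d : X -> X -> \bar R)
  {L : Type} (prec : L -> L -> Prop) (Y : set X) (x : L -> X) : Prop :=
  (forall y, Y y -> (fun l => d y (x l)) @ tails prec --> (0 : \bar R)) /\
  ((fun l => ereal_inf [set d (x l) y | y in Y]) @ tails prec
    --> (0 : \bar R)).

(* Main.v *)
Require Import Defs.
From mathcomp Require Import all_boot all_order all_algebra.
From mathcomp Require Import all_classical all_reals all_analysis.
From mathcomp Require Import lra.
Set Implicit Arguments.
Unset Strict Implicit.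
Unset Printing Implicit Defensive.
Import Order.TTheory GRing.Theory Num.Theory.
Import numFieldNormedType.Exports.
Local Open Scope classical_set_scope.
Local Open Scope ereal_scope.

(** If [Y] is equivalent to the net, then a tail point [x_g] is close to some
    [y] in [Y], and [y] is close to all late [x_l]; so the net is pre-Cauchy.
    Conversely, let [Y] consist of the points that are [d]-below a whole
    [dlower]-ball, of a radius independent of [l], around each late [x_l].  If
    [d x_l x_m] is small for all late [m], then [x_l] is also close to all
    points of small [dlower]-balls around late [x_m].  Applying the hypothesis
    to [x_l] and the union of these balls gives a point of [Y] which is
    [dlower]-close to [x_l]; such points yield both the directedness of [Y] and
    its equivalence with the net. *)

(** * Suprema and infima in [[0, +oo]], and the uniform preorder *)

Section Sup.
Context {R : realType}.
Implicit Types (S : set (\bar R)) (u : \bar R).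

Lemma nneg_sup_ge0 S : 0 <= nneg_sup S.
Proof. by rewrite /nneg_sup le_max lexx orbT. Qed.

Lemma nneg_sup_ubound S u : S u -> u <= nneg_sup S.
Proof. by move=> Su; rewrite /nneg_sup le_max ereal_sup_ubound. Qed.

Lemma nneg_sup_le S u : 0 <= u -> (forall v, S v -> v <= u) -> nneg_sup S <= u.
Proof.
by move=> u0 Su; rewrite /nneg_sup ge_max u0 andbT; apply: ge_ereal_sup.
Qed.

Lemma ereal_inf_eq0 S : (forall v, S v -> 0 <= v) ->
  (forall e : R, (0 < e)%R -> exists2 v, S v & v < e%:E) -> ereal_inf S = 0.
Proof.
move=> S0 Se; apply/eqP; rewrite eq_le; apply/andP; split; last first.
  exact: le_ereal_inf_tmp.
apply/lee_addgt0Pr => e e0; rewrite add0e.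
have [v Sv ve] := Se e e0.
exact: le_trans (ereal_inf_lbound Sv) (ltW ve).
Qed.

End Sup.

(** If no [r] worked for [e], then on the set of pairs where [f] is at least [e] the infimum of [g]
    would be 0, while that of [f] stays at least [e]. *)
Lemma unif_le_eps_delta {R : realType} {A B : Type} (f g : A -> B -> \bar R) :
  (forall a b, 0 <= g a b) -> unif_le f g ->
  forall e : R, (0 < e)%R -> exists2 r : R, (0 < r)%R &
    forall a b, g a b < r%:E -> f a b < e%:E.
Proof.
move=> g0 fg e e0; apply: contrapT => H.
have := fg [set p | e%:E <= f p.1 p.2].
rewrite (@ereal_inf_eq0 _ [set g p.1 p.2 | p in _]); last 2 first.
- by move=> v [p _ <-].
- move=> r r0; apply: contrapT => N; apply: H; exists r => // a b gab.
  rewrite ltNge; apply/negP => fe; apply: N; exists (g a b) => //.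
  by exists (a, b).
move=> /(_ erefl) f0.
have : e%:E <= ereal_inf [set f p.1 p.2 | p in [set p | e%:E <= f p.1 p.2]].
  by apply: le_ereal_inf_tmp => v [p pe <-].
by rewrite f0 lee_fin leNgt e0.
Qed.

(** * Triangle inequalities for [dlower] *)

Section Lower.
Context {R : realType} {X : Type} (d : X -> X -> \bar R).
Hypothesis hd : is_distance d.

Let d_ge0 a b : 0 <= d a b. Proof. exact: hd.1. Qed.

Lemma dlower_ge0 a b : 0 <= dlower d a b.
Proof. exact: nneg_sup_ge0. Qed.

Lemma dlower_triangle_dist c a b : d c b <= d c a + dlower d a b.
Proof.
have : subpos (d c b) (d c a) <= dlower d a b.
  by apply: nneg_sup_ubound; exists c.
rewrite /subpos ge_max => /andP[+ _].
have := d_ge0 c a; case: (d c a) => [r||] //.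
  by move=> _; rewrite leeBlDl.
(* If [d c a = +oo], the truncated difference carries no information, but the right-hand side is
   [+oo] because [dlower] is never [-oo]. *)
by move=> _ _; rewrite addye ?leey// gt_eqF// (lt_le_trans _ (dlower_ge0 _ _)).
Qed.

Lemma dlower_le a b (u : \bar R) : 0 <= u ->
  (forall c, d c b <= d c a + u) -> dlower d a b <= u.
Proof.
move=> u0 H; apply: nneg_sup_le => // _ [c _ <-].
rewrite /subpos ge_max u0 andbT.
have := H c; have := d_ge0 c a; case: (d c a) => [r||] //.
  by move=> _; rewrite leeBlDl.
by move=> _ _; rewrite /= addeNy leNye.
Qed.

Lemma dlower_refl a : dlower d a a = 0.
Proof.
apply/eqP; rewrite eq_le dlower_ge0 andbT.
by apply: dlower_le => // c; rewrite adde0.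
Qed.

Lemma dlower_triangle a b c : dlower d a b <= dlower d a c + dlower d c b.
Proof.
apply: dlower_le; first by rewrite adde_ge0 ?dlower_ge0.
move=> z; rewrite addeA.
apply: le_trans (dlower_triangle_dist z c b) _.
by apply: leeD2r; apply: dlower_triangle_dist.
Qed.

Lemma le_dpow_dist0 a (Z : set X) z : le_dpow d a Z -> Z z -> d a z = 0.
Proof.
move=> aZ Zz; apply/eqP; rewrite eq_le d_ge0 andbT -aZ.
by apply: nneg_sup_ubound; exists z.
Qed.

(** The relation takes only the values 0 and [+oo], so a finite term of the infimum comes from a
    point at which the relation holds. *)
Lemma inf_comp_dlower_lt a (Z : set X) (e : R) :
  inf_comp (dlower d) (rel_dist R (le_dpow d)) a Z < e%:E ->
  exists2 w, dlower d a w < e%:E & forall z, Z z -> d w z = 0.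
Proof.
move=> /ereal_inf_lt[_ [w _ <-]]; rewrite /rel_dist.
case: asboolP => [wZ|_].
  by rewrite adde0 => aw; exists w => // z; exact: le_dpow_dist0.
by rewrite addey// gt_eqF// (lt_le_trans _ (dlower_ge0 _ _)).
Qed.

End Lower.

Lemma lt_splitr {R : realType} (e : R) (u v : \bar R) :
  u < (e / 2)%:E -> v < (e / 2)%:E -> u + v < e%:E.
Proof. by move=> ue ve; rewrite [e in ltRHS]splitr EFinD lteD. Qed.

(** * Epsilon forms of limits along nets *)

Section Nets.
Context {R : realType} {L : Type} (prec : L -> L -> Prop).

Lemma tails_cvg0P (f : L -> \bar R) : (forall l, 0 <= f l) ->
  f @ tails prec --> (0 : \bar R) <->
  forall e : R, (0 < e)%R -> exists g, forall l, prec g l -> f l < e%:E.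
Proof.
move=> f0; split=> [fc e e0|H].
  have /fc[g _ gf] : nbhs (0 : \bar R) [set u | u < e%:E].
    apply: open_nbhs_nbhs; split; first exact: open_ereal_lt_ereal.
    by rewrite /= lte_fin.
  by exists g => l /gf.
move=> A A0.
(* Neighbourhoods of the finite point 0 are determined by their real members; [0 <= f l < e] makes
   [f l] such a member. *)
have /nbhs_ballP[e /= e0 eA] : nbhs (0 : R)%R [set r | A r%:E] by exact: A0.
have [g gf] := H e e0.
exists g => // l /gf /=; have := f0 l; case: (f l) => [r||] //.
rewrite lee_fin lte_fin => r0 re; apply: eA.
by rewrite /ball /= sub0r normrN ger0_norm.
Qed.

Lemma net_limsup_lt (f : L -> \bar R) (e : R) :
  net_limsup prec f < e%:E -> exists g, forall l, prec g l -> f l < e%:E.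
Proof.
move=> /ereal_inf_lt[_ [g _ <-]] ge; exists g => l gl.
by apply: le_lt_trans ge; apply: nneg_sup_ubound; exists l.
Qed.

Lemma net_limsup_le (f : L -> \bar R) (u : \bar R) g : 0 <= u ->
  (forall l, prec g l -> f l <= u) -> net_limsup prec f <= u.
Proof.
move=> u0 fu; apply: le_trans (ereal_inf_lbound _) _; first by exists g.
by apply: nneg_sup_le => // _ [l gl <-]; exact: fu.
Qed.

Lemma net_limsup_ge0 (f : L -> \bar R) : 0 <= net_limsup prec f.
Proof. by apply: le_ereal_inf_tmp => _ [g _ <-]; exact: nneg_sup_ge0. Qed.

Context {X : Type} (d : X -> X -> \bar R).

Lemma pre_cauchyP (x : L -> X) : pre_cauchy d prec x <->
  forall e : R, (0 < e)%R -> exists g, forall l, prec g l ->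
    exists h, forall m, prec h m -> d (x l) (x m) < e%:E.
Proof.
rewrite /pre_cauchy tails_cvg0P; last by move=> l; exact: net_limsup_ge0.
split=> H e e0.
  by have [g gH] := H e e0; exists g => l /gH/net_limsup_lt.
(* Halving restores strictness: a bound on a tail passes to the limit superior only as [<=]. *)
have e20 : (0 < e / 2)%R by rewrite divr_gt0.
have [g gH] := H _ e20.
exists g => l /gH[h hH].
apply: (@le_lt_trans _ _ (e / 2)%:E); last by rewrite lte_fin; lra.
apply: (@net_limsup_le _ _ h); first by rewrite lee_fin; lra.
by move=> m /hH/ltW.
Qed.

Lemma net_equivP (d_ge0 : forall a b, 0 <= d a b) (Y : set X)
    (x : L -> X) : net_equiv d prec Y x <->
  (forall y, Y y -> forall e : R, (0 < e)%R ->
     exists g, forall l, prec g l -> d y (x l) < e%:E) /\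
  (forall e : R, (0 < e)%R -> exists g, forall l, prec g l ->
     exists2 y, Y y & d (x l) y < e%:E).
Proof.
rewrite /net_equiv tails_cvg0P; last first.
  by move=> l; apply: le_ereal_inf_tmp => _ [y _ <-].
split=> -[H1 H2]; split.
- by move=> y /H1; rewrite tails_cvg0P.
- move=> e /H2[g gH]; exists g => l /gH/ereal_inf_lt[_ [y Yy <-]] ?.
  by exists y.
- by move=> y /H1; rewrite tails_cvg0P.
- move=> e /H2[g gH]; exists g => l /gH[y Yy ye].
  by apply: le_lt_trans ye; apply: ereal_inf_lbound; exists y.
Qed.

End Nets.

(** * The directed set attached to a pre-Cauchy net *)

Definition eventually_below {R : realType} {X L : Type} (d : X -> X -> \bar R)
  (prec : L -> L -> Prop) (x : L -> X) : set X :=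
  [set y | exists2 e : R, (0 < e)%R & exists g, forall l, prec g l ->
     forall z, dlower d (x l) z < e%:E -> d y z = 0].

Section EventuallyBelow.
Context {R : realType} {X : Type} (d : X -> X -> \bar R).
Hypothesis hd : is_distance d.
Context {L : Type} (prec : L -> L -> Prop).
Hypothesis hL : net_index prec.
Variable x : L -> X.

Lemma tails_common g h : exists k, forall l, prec k l -> prec g l /\ prec h l.
Proof.
have [_ tr dir] := hL; have [k [gk hk]] := dir g h.
by exists k => l kl; split; [exact: tr gk kl|exact: tr hk kl].
Qed.

Lemma tail_nonempty g : exists l, prec g l.
Proof. by have [_ _ dir] := hL; have [l [gl _]] := dir g g; exists l. Qed.

Lemma eventually_below_dist0 y : eventually_below d prec x y ->
  exists g, forall l, prec g l -> d y (x l) = 0.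
Proof.
move=> [e e0 [g gH]]; exists g => l /gH; apply.
by rewrite dlower_refl// lte_fin.
Qed.

Lemma eventually_below_finite (F : set X) : finite_set F ->
  F `<=` eventually_below d prec x ->
  exists2 e : R, (0 < e)%R & exists g, forall l, prec g l ->
    forall y, F y -> forall z, dlower d (x l) z < e%:E -> d y z = 0.
Proof.
(* [X] carries no decidable equality, hence the alias [{classic X}]. *)
move=> /(@finite_seqP {classic X})[s ->].
elim: s => [_|y s IHs sY].
  by have [[l] _ _] := hL; exists 1%R => //; exists l.
have [|e e0 [g gH]] := IHs.
  by move=> z /= zs; apply: sY; rewrite /= inE zs orbT.
have [|r r0 [h hH]] := sY y; first by rewrite /= inE eqxx.
exists (Num.min e r); first by rewrite lt_min e0.
have [k kH] := tails_common g h; exists k => l /kH[gl hl] u /=.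
rewrite inE => us z; rewrite EFin_min lt_min => /andP[ze zr].
by case/orP: us => [/eqP ->|us]; [exact: hH hl _ zr|exact: gH gl _ us _ ze].
Qed.

Hypothesis hcomp :
  unif_le (inf_comp (dlower d) (rel_dist R (le_dpow d))) (dpow d).
Hypothesis x_pre_cauchy : pre_cauchy d prec x.

Lemma eventually_below_near (e : R) : (0 < e)%R ->
  exists g, forall l, prec g l ->
    exists2 w, eventually_below d prec x w & dlower d (x l) w < e%:E.
Proof.
move=> e0.
have [r r0 rH] := unif_le_eps_delta (fun a Z => nneg_sup_ge0 _) hcomp e0.
(* One quarter of [r] bounds [d (x l) (x m)] and another is the radius of the balls forming [Z].
   Their sum [r / 2] leaves room for the non-strict bound on the supremum [dpow d (x l) Z]. *)
have r40 : (0 < r / 2 / 2)%R by rewrite !divr_gt0.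
have [g gH] := (pre_cauchyP prec d x).1 x_pre_cauchy _ r40.
exists g => l /gH[h hH].
pose Z := [set z | exists2 m, prec h m & dlower d (x m) z < (r / 2 / 2)%:E].
have xZ : dpow d (x l) Z < r%:E.
  apply: (@le_lt_trans _ _ (r / 2)%:E); last by rewrite lte_fin; lra.
  apply: nneg_sup_le; first by rewrite lee_fin; lra.
  move=> _ [z [m hm mz] <-]; apply/ltW.
  apply: le_lt_trans (dlower_triangle_dist hd (x l) (x m) z) _.
  by apply: lt_splitr => //; exact: hH.
have [w lw wZ] := inf_comp_dlower_lt hd (rH _ _ xZ).
(* All the balls in [Z] have the same radius, so [d w z = 0] on [Z] is exactly membership of [w],
   with tail [h]. *)
exists w => //; exists (r / 2 / 2)%R => //.
by exists h => m hm z mz; apply: wZ; exists m.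
Qed.

Lemma eventually_below_directed : lt_directed d (eventually_below d prec x).
Proof.
move=> F finF FY.
(* The radius [e] must be fixed before [l], since how late [l] has to be depends on [e]; hence the
   demand for one radius on a whole tail. Once [w] is within [e / 2] of [x l], the [e / 2]-ball
   around [w] lies in the [e]-ball around [x l]. *)
have [e e0 [g gH]] := eventually_below_finite finF FY.
have e20 : (0 < e / 2)%R by rewrite divr_gt0.
have [h hH] := eventually_below_near e20.
have [k kH] := tails_common g h.
have [l /kH[gl hl]] := tail_nonempty k.
have [w Yw lw] := hH l hl.
exists w => // y Fy; exists (e / 2)%R => // z wz.
apply: (gH l gl y Fy); apply: le_lt_trans (dlower_triangle hd _ _ w) _.
exact: lt_splitr.
Qed.

Lemma eventually_below_equiv : net_equiv d prec (eventually_below d prec x) x.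
Proof.
apply/(net_equivP prec hd.1); split=> [y Yy e e0|e e0].
  have [g gH] := eventually_below_dist0 Yy.
  by exists g => l /gH ->; rewrite lte_fin.
have e20 : (0 < e / 2)%R by rewrite divr_gt0.
have [g gH] := (pre_cauchyP prec d x).1 x_pre_cauchy _ e20.
have [h hH] := eventually_below_near e20.
(* [d (x l) (x l)] need not be small, so the point is taken near a later [x m]. *)
exists g => l /gH[k kH].
have [j jH] := tails_common k h.
have [m /jH[km hm]] := tail_nonempty j.
have [w Yw mw] := hH m hm; exists w => //.
apply: le_lt_trans (dlower_triangle_dist hd (x l) (x m) w) _.
by apply: lt_splitr => //; exact: kH.
Qed.

End EventuallyBelow.

Lemma net_equiv_pre_cauchy {R : realType} {X : Type} (d : X -> X -> \bar R)
  (hd : is_distance d) {L : Type} (prec : L -> L -> Prop) (Y : set X)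
  (x : L -> X) : net_equiv d prec Y x -> pre_cauchy d prec x.
Proof.
move=> /(net_equivP prec hd.1)[H1 H2]; apply/(pre_cauchyP prec d x) => e e0.
have e20 : (0 < e / 2)%R by rewrite divr_gt0.
have [g gH] := H2 _ e20; exists g => l /gH[y Yy ly].
(* The tail [h] depends on [l] through [y], as the iterated limit permits. *)
have [h hH] := H1 y Yy _ e20; exists h => m /hH ym.
by apply: le_lt_trans (hd.2 _ _ y) _; exact: lt_splitr.
Qed.

Theorem theorem11p3 (R : realType) (X : Type) (d : X -> X -> \bar R)
  (hd : is_distance d)
  (hcomp : unif_le (inf_comp (dlower d) (rel_dist R (le_dpow d))) (dpow d))
  (L : Type) (prec : L -> L -> Prop) (hL : net_index prec) (x : L -> X) :
  pre_cauchy d prec x <->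
  exists Y : set X, lt_directed d Y /\ net_equiv d prec Y x.
Proof.
split=> [xc|[Y [_ xY]]]; last exact: net_equiv_pre_cauchy xY.
exists (eventually_below d prec x); split.
  exact: eventually_below_directed.
exact: eventually_below_equiv.
Qed.
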